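(* Let $n = p_1p_2$ where $p_1 < p_2$ are odd primes. Then $$g(\Phi_n) = p_1 - 1.$$
   Context: $\Phi_n$ denotes the $n$-th cyclotomic polynomial, $\Phi_n(x) = \prod_{1\le j\le n,\ \gcd(j,n)=1}(x-\zeta_n^j)$, where $\zeta_n$ is a primitive $n$-th root of unity. Maximum gap: for a nonzero univariate polynomial $f = c_1x^{e_1}+\cdots+c_tx^{e_t}$ with $c_1,\ldots,c_t\neq 0$ and $e_1<\cdots<e_t$, the maximum gap of $f$ is $g(f) = \max_{1\le i<t}(e_{i+1}-e_i)$, with $g(f)=0$ when $t=1$. *)

(* Defs.v *)
From mathcomp Require Import all_boot all_order all_algebra all_field.

Set Implicit Arguments.
Unset Strict Implicit.
Unset Printing Implicit Defensive.

Import GRing.Theory.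
Local Open Scope ring_scope.

(* The exponents e_1 < ... < e_t of the nonzero terms of f, in increasing
   order. *)
Definition exponents (R : nzRingType) (f : {poly R}) : seq nat :=
  [seq i <- iota 0 (size f) | f`_i != 0].

(* With 0-based indices, i < t - 1 gives i.+1 < t, and since e is strictly
   increasing the truncated subtraction is exact.  The empty max is 0, so
   monomials have gap 0; the junk value at f = 0 is 0 as well. *)
Definition max_gap (R : nzRingType) (f : {poly R}) : nat :=
  let e := exponents f in
  (\max_(i < (size e).-1) (nth 0 e i.+1 - nth 0 e i))%N.

(* Main.v *)
Require Import Defs.
From mathcomp Require Import all_boot all_order all_algebra all_field.
From mathcomp Require Import zify ring.

(** Let S be the numerical semigroup generated by p1 and p2.  From
    Phi_n * (X^p1 - 1) * (X^p2 - 1) = (X^n - 1) * (X - 1) one gets the power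
    series identity Phi_n = (1 - X) * \sum_(s in S) X^s, so that k is an exponent
    of Phi_n iff exactly one of k and k - 1 lies in S.  Hence two consecutive
    exponents a < b delimit a run a, ..., b - 1 inside S or inside its complement.
    Since S + p1 is contained in S, b \notin S and a - 1 \in S respectively
    forbid b - a >= p1.  The bound is attained by the run 1, ..., p1 - 1. *)

Set Implicit Arguments.
Unset Strict Implicit.
Unset Printing Implicit Defensive.

Import GRing.Theory.
Local Open Scope ring_scope.

Lemma mem_exponents (R : nzRingType) (f : {poly R}) i :
  (i \in exponents f) = (f`_i != 0).
Proof.
rewrite mem_filter mem_iota add0n /=; case: ltnP; rewrite ?andbT // => le_i.
by rewrite nth_default // eqxx.
Qed.

Lemma sorted_exponents (R : nzRingType) (f : {poly R}) :
  sorted ltn (exponents f).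
Proof. exact/(sorted_filter ltn_trans)/iota_ltn_sorted. Qed.

(** Trades list indices for coefficients: as [exponents f] is strictly sorted, no exponent lies
    strictly between two neighbouring entries. *)
Lemma max_gap_leq (R : nzRingType) (f : {poly R}) g :
  (forall a b, (a < b)%N -> f`_a != 0 -> f`_b != 0 ->
     (forall m, (a < m < b)%N -> f`_m = 0) -> (b - a <= g)%N) ->
  (max_gap f <= g)%N.
Proof.
move=> gapP; apply/bigmax_leqP => i _.
have lt_i : (i.+1 < size (exponents f))%N by have := ltn_ord i; lia.
have mono := sorted_ltn_nth ltn_trans 0%N (sorted_exponents f).
have mono' := sorted_leq_nth leq_trans leqnn 0%N
  (sub_sorted ltnW (sorted_exponents f)).
apply: gapP.
- by apply: mono; rewrite ?inE ?(ltnW lt_i).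
- by rewrite -mem_exponents mem_nth // ltnW.
- by rewrite -mem_exponents mem_nth.
move=> m /andP[lt_im lt_mi]; apply/eqP; apply: contraTT lt_mi => fm.
move: fm lt_im; rewrite -mem_exponents => /(nthP 0%N)[j lt_j <-] lt_ij.
rewrite -leqNgt; apply/mono'; rewrite ?inE //.
rewrite ltnNge; apply: contraTN lt_ij => le_ji.
by rewrite -leqNgt; apply: mono'; rewrite ?inE ?(ltnW lt_i).
Qed.

Lemma leq_max_gap (R : nzRingType) (f : {poly R}) a b :
    (a < b)%N -> f`_a != 0 -> f`_b != 0 ->
    (forall m, (a < m < b)%N -> f`_m = 0) ->
  (b - a <= max_gap f)%N.
Proof.
move=> lt_ab; rewrite -!mem_exponents => /(nthP 0%N)[i lt_i ia].
move=> /(nthP 0%N)[j lt_j jb] gap0.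
have mono := sorted_ltn_nth ltn_trans 0%N (sorted_exponents f).
have mono' := sorted_leq_nth leq_trans leqnn 0%N
  (sub_sorted ltnW (sorted_exponents f)).
have lt_ij : (i < j)%N.
  rewrite ltnNge; apply: contraTN lt_ab => le_ji.
  by rewrite -leqNgt -ia -jb; apply: mono'.
have lt_i1 : (i.+1 < size (exponents f))%N by apply: leq_ltn_trans lt_ij lt_j.
(* Otherwise the entry at index [i.+1] would be an exponent strictly between [a] and [b]. *)
have def_j : j = i.+1.
  apply/eqP; rewrite eqn_leq lt_ij andbT leqNgt; apply/negP => lt_i1j.
  have := mem_nth 0%N lt_i1; rewrite mem_exponents gap0 ?eqxx //.
  by rewrite -{1}ia -jb !mono ?inE.
have lt_i' : (i < (size (exponents f)).-1)%N by lia.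
by rewrite -ia -jb def_j (@leq_bigmax _ _ (Ordinal lt_i')).
Qed.

Lemma divisors_prime p : prime p -> perm_eq (divisors p) [:: 1%N; p].
Proof.
move=> pr_p; have p_gt1 := prime_gt1 pr_p.
apply: uniq_perm; rewrite ?divisors_uniq //= ?inE ?andbT ?neq_ltn ?p_gt1 //.
move=> d; rewrite -dvdn_divisors ?prime_gt0 // !inE; apply/idP/orP.
  by have [_ prP] := primeP pr_p => /prP/orP.
by case=> /eqP->; rewrite ?dvd1n.
Qed.

Lemma divisors_prime_mul p q : prime p -> prime q -> p != q ->
  perm_eq (divisors (p * q)) [:: 1; p; q; p * q]%N.
Proof.
move=> pr_p pr_q neq_pq; have p_gt1 := prime_gt1 pr_p.
have q_gt1 := prime_gt1 pr_q.
apply: uniq_perm; first exact: divisors_uniq.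
  rewrite /= !inE !negb_or; move/eqP: neq_pq => neq_pq.
  by rewrite !andbT; repeat (apply/andP; split); apply/eqP; nia.
move=> d; rewrite -dvdn_divisors ?muln_gt0 ?prime_gt0 // !inE.
have dvd_prime r e : prime r -> (e %| r)%N -> e = 1%N \/ e = r.
  by move=> /primeP[_ prP] /prP/orP[]/eqP; [left | right].
apply/idP/idP => [dvd_d |]; last first.
  by case/or4P => /eqP->; [exact: dvd1n | exact: dvdn_mulr | exact: dvdn_mull | ].
have [/dvdnP[e def_d] | ndvd_pd] := boolP (p %| d)%N.
  move: dvd_d; rewrite def_d mulnC dvdn_pmul2l ?prime_gt0 //.
  by case/(dvd_prime _ _ pr_q) => ->; rewrite ?muln1 eqxx ?orbT.
move: dvd_d; rewrite Gauss_dvdr; last by rewrite coprime_sym prime_coprime.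
by case/(dvd_prime _ _ pr_q) => ->; rewrite eqxx ?orbT.
Qed.

(** The product of ['Phi_d] over the divisors [d] of [p * q] is ['X^(p * q) - 1], that is,
    ['X^q - 1] times a geometric sum in ['X^q]. Cancelling ['X^q - 1 = 'Phi_1 * 'Phi_q] and
    multiplying by ['X - 1] gives the claim. *)
Lemma Cyclotomic_prime_mul p q : prime p -> prime q -> p != q ->
  'Phi_(p * q) * ('X^p - 1) = \sum_(j < p) ('X^(q * j + 1) - 'X^(q * j)).
Proof.
move=> pr_p pr_q neq_pq.
have p_gt0 := prime_gt0 pr_p; have q_gt0 := prime_gt0 pr_q.
have Phi1 : 'Phi_1 = 'X - 1.
  by rewrite -['X]expr1 -prod_Cyclotomic // big_seq1.
have PhiP r : prime r -> ('X - 1) * 'Phi_r = 'X^r - 1.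
  move=> pr_r; rewrite -(@prod_Cyclotomic r) ?prime_gt0 // -Phi1.
  by rewrite (perm_big _ (divisors_prime pr_r)) !big_cons big_nil /= mulr1.
have := prod_Cyclotomic (_ : 0 < p * q)%N; rewrite muln_gt0 p_gt0 => /(_ q_gt0).
rewrite (perm_big _ (divisors_prime_mul pr_p pr_q neq_pq)) !big_cons big_nil /=.
rewrite mulr1 Phi1 [in 'X^(p * q)]mulnC exprM subrX1 => prodPhi.
have nzX1 r : (0 < r)%N -> 'X^r - 1 != 0 :> {poly int}.
  by move=> r_gt0; rewrite -size_poly_eq0 size_XnsubC.
apply: (mulfI (nzX1 q q_gt0)); rewrite -(PhiP p) //.
transitivity
  (('X - 1) * (('X - 1) * ('Phi_p * ('Phi_q * 'Phi_(p * q)))) : {poly int}).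
  by rewrite -(PhiP q) //; ring.
rewrite prodPhi mulrCA; congr (_ * _); rewrite mulr_sumr.
by apply: eq_bigr => j _; rewrite -exprM exprD expr1; ring.
Qed.

(* Indicator of m + p * nat; the semigroup S is the disjoint union of the
   progressions q * j + p * nat for j < p. *)
Definition in_progression (p m k : nat) : bool := (m <= k)%N && (p %| k - m)%N.

(** Coefficient form of F = X^m + X^p F for the series F = X^m / (1 - X^p). The guard [p <= k] is
    needed because [k - p] truncates to 0. *)
Lemma in_progression_step p m k : (0 < p)%N ->
  ((k == m) + ((p <= k) && in_progression p m (k - p)) = in_progression p m k)%N.
Proof.
move=> p_gt0; rewrite /in_progression.
have [->|] := eqVneq k m.
  rewrite leqnn subnn dvdn0; case: (leqP p m) => //= le_pm.
  by rewrite leqNgt ltn_subrL p_gt0 (leq_trans p_gt0 le_pm).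
move=> neq_km; rewrite /= add0n; congr nat_of_bool.
have [le_mk | lt_km] := leqP m k; last first.
  by rewrite [(m <= _)%N]leqNgt (leq_ltn_trans (leq_subr _ _) lt_km) andbF.
have [le_pkm | lt_kmp] := leqP p (k - m); last first.
  rewrite [RHS]gtnNdvd //; last by rewrite subn_gt0 ltn_neqAle eq_sym neq_km.
  by apply/negP => /and3P[]; lia.
rewrite (leq_trans le_pkm (leq_subr _ _)) /= subnAC dvdn_subl //.
by have -> : (m <= k - p)%N by lia.
Qed.

(** Division by ['X^p - 1] without power series: both sides satisfy the same recursion from [k - p]
    to [k], so strong induction on [k] applies. *)
Lemma coef_Cyclotomic_prime_mul p q k : prime p -> prime q -> p != q ->
  'Phi_(p * q)`_k = \sum_(j < p) ((in_progression p (q * j) k)%:R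
                                 - (in_progression p (q * j + 1) k)%:R).
Proof.
move=> pr_p pr_q neq_pq; have p_gt0 := prime_gt0 pr_p.
elim/ltn_ind: k => k IHk.
have := congr1 (fun f : {poly int} => f`_k) (Cyclotomic_prime_mul pr_p pr_q neq_pq).
rewrite mulrBr mulr1 coefB coefMXn coef_sum.
under eq_bigr do rewrite coefB !coefXn.
move/eqP; rewrite subr_eq addrC -subr_eq => /eqP <-.
under [RHS]eq_bigr do rewrite -!in_progression_step // !natrD.
case: ltnP => [lt_kp | le_pk].
  rewrite sub0r -sumrN; apply: eq_bigr => j _ /=.
  by rewrite !addr0 opprB.
rewrite IHk; last by rewrite ltn_subrL p_gt0 (leq_trans p_gt0).
by rewrite -sumrB; apply: eq_bigr => j _ /=; ring.
Qed.

(** Bounding [j] by [p] loses nothing, since [p] copies of [q] can be traded for [q] copies of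
    [p]. *)
Definition in_semigroup (p q k : nat) : bool :=
  [exists j : 'I_p, in_progression p (q * j) k].

(** The progressions are disjoint: if those of [i <= j] share [k], then [p] divides [q * (j - i)],
    hence [j - i], which is less than [p]. *)
Lemma in_semigroupE p q k : coprime p q ->
  in_semigroup p q k = (\sum_(j < p) in_progression p (q * j) k)%N :> nat.
Proof.
move=> co_pq; rewrite /in_semigroup.
have [[j Sj] | nS] := existsP; last first.
  rewrite big1 // => j _; apply/eqP; rewrite eqb0.
  by apply/negP => Sj; case: nS; exists j.
rewrite (bigD1 j) //= Sj big1 // => i neq_ij; apply/eqP; rewrite eqb0.
apply: contraNN neq_ij => Si; apply/eqP/val_inj => /=.
wlog le_ij : i j Si Sj / (i <= j)%N.
  by move=> IH; case/orP: (leq_total i j) => ?; [|symmetry]; apply: IH.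
case/andP: Si Sj => le_ik dvd_i /andP[le_jk dvd_j].
have : (p %| q * (j - i))%N.
  rewrite mulnBr; have -> : (q * j - q * i = (k - q * i) - (k - q * j))%N.
    by have := leq_mul (leqnn q) le_ij; lia.
  exact: dvdn_sub.
rewrite Gauss_dvdr //.
case: (posnP (j - i)) => [eq0 _ | ji_gt0 /(dvdn_leq ji_gt0) le_p].
  by apply/eqP; rewrite eqn_leq le_ij -subn_eq0 eq0.
by have := leq_ltn_trans (leq_trans le_p (leq_subr _ _)) (ltn_ord j); rewrite ltnn.
Qed.

Lemma in_semigroup0 p q : (0 < p)%N -> in_semigroup p q 0.
Proof.
by move=> p_gt0; apply/existsP; exists (Ordinal p_gt0);
  rewrite /in_progression muln0 dvdn0.
Qed.

Lemma in_semigroup_addn p q k : in_semigroup p q k -> in_semigroup p q (k + p).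
Proof.
case/existsP => j /andP[le_k dvd_k]; apply/existsP; exists j.
by rewrite /in_progression (leq_trans le_k) ?leq_addr // -addnBAC // dvdn_addl.
Qed.

Lemma in_semigroup_small p q k : (0 < p)%N -> (k < q)%N ->
  in_semigroup p q k = (p %| k)%N.
Proof.
move=> p_gt0 lt_kq; apply/existsP/idP => [[j /andP[]] | dvd_k].
  case: (posnP j) => [-> | j_gt0 le_qk]; first by rewrite muln0 subn0.
  by have := leq_mul (leqnn q) j_gt0; lia.
by exists (Ordinal p_gt0); rewrite /in_progression /= muln0 subn0.
Qed.

(** The progression from [q * j + 1] contains [k.+1] exactly when the one from [q * j] contains [k],
    so each of the two sums is an indicator of the semigroup. *)
Lemma coefS_Cyclotomic_prime_mul p q k : prime p -> prime q -> p != q ->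
  'Phi_(p * q)`_k.+1 = (in_semigroup p q k.+1)%:R - (in_semigroup p q k)%:R.
Proof.
move=> pr_p pr_q neq_pq; rewrite coef_Cyclotomic_prime_mul // sumrB -!natr_sum.
rewrite !in_semigroupE ?prime_coprime ?dvdn_prime2 //.
congr (_ - (_)%:R); apply: eq_bigr => j _.
by rewrite /in_progression addn1 ltnS subSS.
Qed.

Lemma coefS_Cyclotomic_prime_mul_eq0 p q k : prime p -> prime q -> p != q ->
  ('Phi_(p * q)`_k.+1 == 0) = (in_semigroup p q k.+1 == in_semigroup p q k).
Proof.
move=> pr_p pr_q neq_pq; rewrite coefS_Cyclotomic_prime_mul //.
by do 2!case: in_semigroup.
Qed.

Theorem theorem1 (n p1 p2 : nat)
    (p1_prime : prime p1) (p2_prime : prime p2)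
    (p1_odd : odd p1) (p2_odd : odd p2)
    (lt_p12 : (p1 < p2)%N) (def_n : n = (p1 * p2)%N) :
  max_gap 'Phi_n = (p1 - 1)%N.
Proof.
rewrite {n}def_n.
have neq_p12 : p1 != p2 by rewrite ltn_eqF.
have p1_gt2 : (2 < p1)%N by rewrite odd_prime_gt2.
have p1_gt0 := prime_gt0 p1_prime.
have coefS := coefS_Cyclotomic_prime_mul_eq0 _ p1_prime p2_prime neq_p12.
have S_small k := @in_semigroup_small p1 p2 k p1_gt0.
apply/eqP; rewrite eqn_leq; apply/andP; split.
  apply: max_gap_leq => a [//|b] lt_ab nz_a; rewrite coefS => neq_b run.
  (* The consecutive exponents are [a] and [b.+1]; membership is constant on the run from [a] to [b]
     and changes at [b.+1]. *)
  have constS i : (a + i <= b)%N ->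
      in_semigroup p1 p2 (a + i) = in_semigroup p1 p2 a.
    elim: i => [|i IHi] le_b; first by rewrite addn0.
    rewrite -IHi ?addnS; last by lia.
    have /eqP: 'Phi_(p1 * p2)`_(a + i).+1 = 0 by apply: run; lia.
    by rewrite coefS => /eqP.
  rewrite leqNgt; apply/negP => gap_gt.
  have Sb : in_semigroup p1 p2 b = in_semigroup p1 p2 a.
    by rewrite -(constS (b - a)%N); [congr in_semigroup; lia | lia].
  have [Sa | nSa] := boolP (in_semigroup p1 p2 a).
    have Sb1 : in_semigroup p1 p2 b.+1.
      (* The run is long enough to contain [b.+1 - p1], so [b.+1] stays in the semigroup. *)
      have -> : (b.+1 = a + (b.+1 - p1 - a) + p1)%N by lia.
      by apply: in_semigroup_addn; rewrite constS //; lia.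
    by rewrite Sb1 Sb Sa in neq_b.
  (* The run now starts at [a.+1], with [a] in the semigroup; [a + p1] still falls in the run. *)
  case: a => [|a] in lt_ab nz_a run constS gap_gt Sb nSa *.
    by rewrite in_semigroup0 in nSa.
  have Sa : in_semigroup p1 p2 a.
    by move: nz_a; rewrite coefS (negPf nSa); case: in_semigroup.
  have := in_semigroup_addn Sa.
  have -> : (a + p1 = a.+1 + p1.-1)%N by lia.
  by rewrite constS ?(negPf nSa) //; lia.
(* Unification selects the exponents 1 and [p1]. All indices involved are below [p2], where the
   semigroup consists of the multiples of [p1]. *)
apply: leq_max_gap; first by lia.
- by rewrite coefS !S_small ?dvdn0 ?(gtnNdvd (ltn0Sn 0) (ltnW p1_gt2)) //; lia.
- rewrite -[X in _`_X](prednK p1_gt0) coefS prednK // !S_small ?dvdnn; [|lia..].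
  by rewrite gtnNdvd; lia.
case=> // m /andP[m_gt0 lt_m]; apply/eqP; rewrite coefS !S_small; [|lia..].
by rewrite !gtnNdvd //; lia.
Qed.
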